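(* Let $X$ be a compact ultrametric space and $Y$ be any complete (nonempty) metric space. Then for any $A\subset X$, any Lipschitz function $f\colon A\to Y$ can be extended to $X$ as a Lipschitz function $X\to Y$ with the same Lipschitz constant.
   Context: A metric space $(X,d)$ is ultrametric if $d(x,y)\le\max\{d(x,z),d(y,z)\}$ for all $x,y,z\in X$. A function $f$ between metric spaces is Lipschitz with (Lipschitz) constant $C<\infty$ if $d_Y(f(x),f(z))\le C\,d_X(x,z)$ for all $x,z$ in its domain. *)

(* Defs.v *)
From HB Require Import structures.
From mathcomp Require Import all_boot all_order all_algebra.
From mathcomp Require Import all_classical all_reals all_analysis.

Set Implicit Arguments.
Unset Strict Implicit.
Unset Printing Implicit Defensive.

Import Order.TTheory GRing.Theory Num.Theory.

Local Open Scope classical_set_scope.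
Local Open Scope ring_scope.

(* A subset A of a metric space, seen as a type, already carries the induced
   pseudometric; this makes it a metric space for the restricted distance. *)
Section SubspaceMetric.
Context {R : realType} {X : metricType R} (A : set X).

Definition sub_mdist (x z : A) : R := mdist (set_val x) (set_val z).

Let sub_mdist_ge0 x z : 0 <= sub_mdist x z.
Proof. exact: mdist_ge0. Qed.

Let sub_mdist_positivity x z : sub_mdist x z = 0 -> x = z.
Proof. by move=> /mdist_positivity /val_inj. Qed.

Let sub_ballEmdist (x : A) (d : R) : ball x d = [set z | sub_mdist x z < d].
Proof.
have -> : ball x d = [set z | ball (set_val x) d (set_val z)] by [].
by rewrite ballEmdist.
Qed.

HB.instance Definition _ := @PseudoMetric_isMetric.Build R A sub_mdist
  sub_mdist_ge0 sub_mdist_positivity sub_ballEmdist.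

End SubspaceMetric.

Definition ultrametric (R : realType) (X : metricType R) : Prop :=
  forall x y z : X, mdist x y <= Num.max (mdist x z) (mdist y z).

(* Same condition as the mixin of completeType, but for a space which is not
   required to be pointed. *)
Definition complete_space (T : uniformType) : Prop :=
  forall F : set_system T, ProperFilter F -> cauchy F -> exists y : T, F --> y.

Definition lipschitz_const (R : realType) (X Y : metricType R) (C : R)
    (f : X -> Y) : Prop :=
  forall x z : X, mdist (f x) (f z) <= C * mdist x z.

(* Main.v *)
Require Import Defs.
From mathcomp Require Import all_boot all_order all_algebra.
From mathcomp Require Import all_classical all_reals all_analysis.
From mathcomp Require Import lra.

Import Order.TTheory GRing.Theory Num.Theory.
Import numFieldNormedType.Exports.
Local Open Scope classical_set_scope.
Local Open Scope ring_scope.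

(* In an ultrametric space, a nearest-point map onto a compact set B is
   1-Lipschitz as soon as the nearest point of x is chosen as a function of the
   set of all points of B nearest to x: if x and y are closer to each other
   than to B, then they have the same nearest points.  Since Y is complete, f
   extends to the closure of A, which is compact; composing this extension
   with such a nearest-point map onto the closure preserves the constant. *)

Lemma continuous_mdist {R : realType} {X : metricType R} (x : X) :
  continuous (mdist x : X -> R).
Proof.
move=> z; apply/cvgrPdist_lt => e e0.
apply/metricType_numDomainType.nbhs_mdistP; exists e => //= t /= zt.
have := metric_triangle x z t; have := metric_triangle x t z.
by rewrite (metric_sym t z) ltr_norml; lra.
Qed.

Lemma closure_mdistP {R : realType} {X : metricType R} (A : set X) (p : X) :
  closure A p <-> forall e, 0 < e -> exists2 a, A a & mdist p a < e.
Proof.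
split=> [Ap e e0|Ap U].
  have [a [Aa]] := Ap _ (nbhsx_ballx p _ e0).
  by rewrite ballEmdist; exists a.
rewrite -nbhs_ballE => -[e /= e0 peU].
have [a Aa pa] := Ap e e0; exists a; split => //; apply: peU.
by rewrite ballEmdist.
Qed.

Definition nearest {R : realType} {X : metricType R} (B : set X) (x : X) :
  set X := [set p | B p /\ forall q, B q -> mdist x p <= mdist x q].

Lemma nearest_neq0 {R : realType} {X : metricType R} {B : set X} (x : X) :
  B !=set0 -> compact B -> nearest B x !=set0.
Proof.
move=> B0 cB.
have [p Bp pmin] := compact_EVT_min B0 cB
  (continuous_subspaceT (continuous_mdist x)).
exists p; split; first by rewrite inE in Bp.
by move=> q Bq; apply: pmin; rewrite inE.
Qed.

(** The two longest sides of an ultrametric triangle are equal, and the side [x y] is not among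
    them. *)
Lemma ultrametric_isosceles {R : realType} {X : metricType R} (x y q : X) :
  ultrametric X -> mdist x y < mdist x q -> mdist y q = mdist x q.
Proof.
move=> uX xyq.
have := uX x q y; have := uX y q x.
rewrite (metric_sym q x) (metric_sym y x) (metric_sym q y) !le_max.
by move=> /orP[] ? /orP[] ?; lra.
Qed.

(** No point of [B] is nearer to [x] than [p], so by the isosceles property each point of [B] is
    equidistant from [x] and [y]. *)
Lemma nearest_eq {R : realType} {X : metricType R} {B : set X} {x y p : X} :
  ultrametric X -> nearest B x p -> mdist x y < mdist x p ->
  nearest B x = nearest B y.
Proof.
move=> uX [Bp pmin] xyp.
have yB q : B q -> mdist y q = mdist x q.
  by move=> Bq; apply: ultrametric_isosceles => //; exact: lt_le_trans (pmin _ Bq).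
apply/seteqP; split=> r [Br rmin]; split=> // q Bq.
  by rewrite !yB//; exact: rmin.
by rewrite -!yB//; exact: rmin.
Qed.

Lemma ultrametric_retraction {R : realType} {X : metricType R} {B : set X} :
  ultrametric X -> B !=set0 -> compact B ->
  exists r : X -> X, [/\ forall x, B (r x), forall x, B x -> r x = x &
    lipschitz_const 1 r].
Proof.
move=> uX B0 cB; have [b _] := B0.
(* [xget] depends only on the set [nearest B x], so equal sets give equal values of [r]; these sets
   are nonempty, so the default [b] does not interfere. *)
pose r x := xget b (nearest B x).
have rP x : nearest B x (r x) by apply: xgetPex; exact: nearest_neq0.
exists r; split=> [x|x Bx|x y].
- by have [] := rP x.
- have [_ /(_ x Bx)] := rP x; rewrite mdistxx => rx.
  by apply/esym/mdist_positivity/eqP; rewrite eq_le rx mdist_ge0.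
- rewrite mul1r.
  have [xyx|xyx] := ltP (mdist x y) (mdist x (r x)).
    by rewrite /r (nearest_eq uX (rP x) xyx) mdistxx mdist_ge0.
  have [xyy|xyy] := ltP (mdist x y) (mdist y (r y)).
    rewrite metric_sym in xyy.
    by rewrite /r (nearest_eq uX (rP y) xyy) mdistxx mdist_ge0.
  (* Now [x] and [y] are both within [mdist x y] of their images; the chain [r x], [x], [y], [r y]
     has no longer step. *)
  have := uX (r x) (r y) y; have := uX (r x) y x.
  rewrite (metric_sym (r x) x) (metric_sym (r y) y) (metric_sym y x) !le_max.
  by move=> /orP[] ? /orP[] ?; lra.
Qed.

Section ExtensionToClosure.
Context {R : realType} {X Y : metricType R} {A : set X} {C : R} {f : A -> Y}.
Hypotheses (C_ge0 : 0 <= C) (f_lipschitz : lipschitz_const C f).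

(* (p, y) lies in the closure of the graph of f. *)
Let limit_value (p : X) (y : Y) := forall e, 0 < e ->
  exists a : A, mdist p (set_val a) < e /\ mdist y (f a) < e.

Let limit_value_lipschitz {p q y z} : limit_value p y -> limit_value q z ->
  mdist y z <= C * mdist p q.
Proof.
move=> py qz; apply/ler_addgt0Pl => e e0.
(* With precision e' at both points, the error is 2 e' in [Y] plus C times 2 e' from [X], hence e' =
   e / (2 (C + 1)). *)
have C1 : 0 < 2 * (C + 1) by rewrite mulr_gt0 ?ltr_wpDl.
have [a [pa ya]] := py _ (divr_gt0 e0 C1).
have [b [qb zb]] := qz _ (divr_gt0 e0 C1).
have e'E : e = 2 * (C + 1) * (e / (2 * (C + 1))).
  by rewrite mulrC divfK// gt_eqF.
move: (e / _) => e' in e'E pa ya qb zb *.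
have fab : mdist (f a) (f b) <= C * mdist (set_val a) (set_val b).
  exact: f_lipschitz.
have yz : mdist y z <= mdist y (f a) + mdist (f a) (f b) + mdist z (f b).
  have := metric_triangle y (f a) z; have := metric_triangle (f a) (f b) z.
  by rewrite (metric_sym (f b) z); lra.
have ab : mdist (set_val a) (set_val b) <=
    mdist p (set_val a) + mdist p q + mdist q (set_val b).
  have := metric_triangle (set_val a) p (set_val b).
  by have := metric_triangle p q (set_val b); rewrite (metric_sym (set_val a) p); lra.
have : C * mdist (set_val a) (set_val b) <= C * (e' + mdist p q + e').
  by apply: ler_wpM2l => //; lra.
by rewrite e'E; lra.
Qed.

(** The traces on [A] of the balls around [p] generate a proper filter; its image under [f] is
    Cauchy, and any limit of that image is a limit value. *)
Let limit_value_ex p : complete_space Y -> closure A p -> exists y, limit_value p y.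
Proof.
move=> cY /closure_mdistP Ap.
pose V (e : R) : set A := [set a | mdist p (set_val a) < e].
pose F := filter_from [set e : R | 0 < e] V.
have FF : ProperFilter F.
  apply: filter_from_proper; last first.
    move=> e /= e0; have [a Aa pa] := Ap e e0.
    by exists (SigSub (mem_set Aa)).
  apply: filter_from_filter; first by exists 1 => /=.
  move=> d e /= d0 e0; exists (Num.min d e); first by rewrite /= lt_min d0.
  by move=> a; rewrite /V /= lt_min => /andP[].
have [|y Fy] := cY (f @ F) _.
  apply: cauchy_exP => e e0.
  have C1 : 0 < 2 * (C + 1) by rewrite mulr_gt0 ?ltr_wpDl.
  have e'0 := divr_gt0 e0 C1.
  have [a Aa pa] := Ap _ e'0.
  (* Points of [A] within e' of [p] are within 2 e' of [a], so their images are within 2 C e' < e of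
     the image of [a]. *)
  exists (f (SigSub (mem_set Aa))); exists (e / (2 * (C + 1))) => //= b /= pb.
  rewrite ballEmdist /=.
  apply: le_lt_trans (f_lipschitz _ _) _; rewrite /mdist /= /sub_mdist /=.
  have e'E : e = 2 * (C + 1) * (e / (2 * (C + 1))).
    by rewrite mulrC divfK// gt_eqF.
  rewrite /V /= in pb.
  move: (e / _) => e' in e'E e'0 pa pb *.
  have ab : mdist a (set_val b) <= 2 * e'.
    by have := metric_triangle a p (set_val b); rewrite (metric_sym a p); lra.
  by have := ler_wpM2l C_ge0 ab; rewrite e'E; lra.
exists y => e e0.
have Fa : F [set a | mdist p (set_val a) < e] by exists e.
have Fya : F [set a | mdist y (f a) < e].
  by have := Fy _ (nbhsx_ballx y _ e0); rewrite ballEmdist.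
by have [a [pa ya]] := filter_ex (filterI Fa Fya); exists a.
Qed.

Lemma lipschitz_closure_extension : complete_space Y -> Y ->
  exists g : X -> Y, (forall a : A, g (set_val a) = f a) /\
    forall p q, closure A p -> closure A q ->
      mdist (g p) (g q) <= C * mdist p q.
Proof.
move=> cY y0.
pose g p := xget y0 (limit_value p).
have gP p : closure A p -> limit_value p (g p).
  by move=> Ap; apply: xgetPex; exact: limit_value_ex.
exists g; split=> [a|p q Ap Aq]; last by apply: limit_value_lipschitz; exact: gP.
have Aa : closure A (set_val a) by apply: subset_closure; exact: set_valP.
(* Limit values at one point are at distance at most C times 0, so [g] must agree with [f] on
   [A]. *)
have fa : limit_value (set_val a) (f a) by move=> e e0; exists a; rewrite !mdistxx.
have := limit_value_lipschitz (gP _ Aa) fa; rewrite mdistxx mulr0 => ga.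
by apply/mdist_positivity/eqP; rewrite eq_le ga mdist_ge0.
Qed.

End ExtensionToClosure.

Theorem lemma1p6 (R : realType) (X Y : metricType R)
    (X_compact : compact [set: X]) (X_ultrametric : ultrametric X)
    (Y_complete : complete_space Y) (Y_nonempty : [set: Y] !=set0)
    (A : set X) (C : R) (C_ge0 : 0 <= C)
    (f : A -> Y) (f_lipschitz : lipschitz_const C f) :
  exists g : X -> Y,
    (forall a : A, g (set_val a) = f a) /\ lipschitz_const C g.
Proof.
have [y0 _] := Y_nonempty.
(* An empty closure admits no retraction, so for empty [A] a constant map is taken. *)
have [A0|/set0P A0] := eqVneq A set0.
  exists (fun=> y0); split=> [a|x z].
    by have /seteqP[/(_ _ (set_valP a))] := A0.
  by rewrite mdistxx mulr_ge0// mdist_ge0.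
have clA0 : closure A !=set0 by apply: subset_nonempty A0; exact: subset_closure.
have clA_compact : compact (closure A).
  by apply: subclosed_compact X_compact _; first exact: closed_closure.
have [r [rA rid r_lipschitz]] :=
  ultrametric_retraction X_ultrametric clA0 clA_compact.
have [g [gf g_lipschitz]] :=
  lipschitz_closure_extension C_ge0 f_lipschitz Y_complete y0.
exists (g \o r); split=> [a|x z] /=.
  by rewrite rid ?gf//; apply: subset_closure; exact: set_valP.
apply: le_trans (g_lipschitz _ _ (rA x) (rA z)) _.
by rewrite ler_wpM2l// -[leRHS]mul1r; exact: r_lipschitz.
Qed.
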